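(* Let $K$ be a field of characteristic zero, and let $\alpha:K[X,Y]\to K[X,Y]$ be the exchange involution $X\leftrightarrow Y$. If $f:K[X,Y]\to K[X,Y]$ is an $\alpha$-morphism that satisfies $\operatorname{Jac}(f(X),f(Y))=1$, then $f$ is an automorphism.
   Context: $K[X,Y]$ is the commutative polynomial $K$-algebra in two variables. The exchange involution $\alpha$ is the $K$-algebra homomorphism with $\alpha(X)=Y$, $\alpha(Y)=X$. An $\alpha$-morphism is a $K$-algebra endomorphism $f$ of $K[X,Y]$ with $f\circ\alpha=\alpha\circ f$. For $P,Q\in K[X,Y]$, $\operatorname{Jac}(P,Q)=\frac{\partial P}{\partial X}\frac{\partial Q}{\partial Y}-\frac{\partial P}{\partial Y}\frac{\partial Q}{\partial X}$ is the Jacobian determinant. *)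

(* Defs.v *)
From HB Require Import structures.
From mathcomp Require Import all_boot all_order all_algebra.
From mathcomp Require Import mpoly.

Set Implicit Arguments.
Unset Strict Implicit.
Unset Printing Implicit Defensive.

Import GRing.Theory.
Local Open Scope ring_scope.

Section ExchangeInvolution.
Variable K : fieldType.

Definition varX : {mpoly K[2]} := 'X_(ord0 : 'I_2).
Definition varY : {mpoly K[2]} := 'X_(ord_max : 'I_2).

Definition exchange : {mpoly K[2]} -> {mpoly K[2]} :=
  comp_mpoly [tuple varY; varX].

HB.instance Definition _ := GRing.LRMorphism.copy exchange
  (comp_mpoly [tuple varY; varX]).

Lemma exchangeX : exchange varX = varY.
Proof. by rewrite /exchange /varX comp_mpolyXU. Qed.

Lemma exchangeY : exchange varY = varX.
Proof. by rewrite /exchange {1}/varY comp_mpolyXU. Qed.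

Definition alpha_morphism
    (f : {lrmorphism {mpoly K[2]} -> {mpoly K[2]}}) : Prop :=
  f \o exchange =1 exchange \o f.

Definition Jac (P Q : {mpoly K[2]}) : {mpoly K[2]} :=
  P^`M(ord0) * Q^`M(ord_max) - P^`M(ord_max) * Q^`M(ord0).

End ExchangeInvolution.

Arguments varX {K}.
Arguments varY {K}.
Arguments exchange {K}.

(* Main.v *)
From HB Require Import structures.
Require Import Defs.
From mathcomp Require Import all_boot all_order all_algebra.
From mathcomp Require Import mpoly ring zify.

Import GRing.Theory.
Local Open Scope ring_scope.

(** The linear involution [lam : X |-> X, Y |-> X - Y] carries the exchange
    involution to one fixing the axis [Y = 0] pointwise.  Since [f] commutes
    with the exchange, [f (X - Y)] is antisymmetric, hence vanishes on the
    diagonal; so for the conjugate [g := lam \o f \o lam] the polynomial [g Y]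
    vanishes on the axis [Y = 0], and [Jac (g X) (g Y)] is still [1] by the
    chain rule ([Jac_lrmorph]).  It remains to see that a Jacobian pair
    [A, B] such that [B] vanishes on [Y = 0] is triangular:
    [A = a X + r(Y)] and [B = b Y] with [a b = 1] ([msupp_triangular]), because
    triangular maps are visibly invertible ([triangular_bijective]).

    The triangular shape is read off the Newton polygons of [A] and [B].
    Multiplied by [X Y], the Jacobian is diagonal on monomials: the pair
    [X^m0 Y^m1, X^n0 Y^n1] contributes the determinant [m0 n1 - m1 n0] at the
    exponent [m + n].  Comparing constant terms, [X] occurs in [A] and [Y] in
    [B].  Take a weight [p * m0 + q * m1] with [q <= 0 <= p] and [q < p] for
    which [X] has maximal weight in [A] and [Y] maximal weight in [B].  Among
    the monomials of maximal weight, take those of highest degree in [A] and in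
    [B]: their product arises in only one way, and their determinant is
    positive, so in characteristic zero it survives in [X Y Jac A B = X Y], and
    the two monomials have degree [1] ([mdeg_leading_form_le1]).  If some
    monomial contradicted the triangular shape, then, [A] being compared
    with [X] and [B] with [Y], such a monomial of extremal slope would
    determine a weight of this kind for which it has maximal weight and degree
    larger than [1]. *)

(** * Endomorphisms of the polynomial algebra in two variables *)

Section TwoVariables.
Set Implicit Arguments.
Unset Strict Implicit.

Variable K : fieldType.
Implicit Types (m n : 'X_{1..2}) (p q P Q : {mpoly K[2]}).
Implicit Types g h : {lrmorphism {mpoly K[2]} -> {mpoly K[2]}}.

Lemma mnm2P m n : m ord0 = n ord0 -> m ord_max = n ord_max -> m = n.
Proof.
move=> e0 e1; apply/mnmP => i.
have [->|->] // : i = ord0 \/ i = ord_max.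
by case: i => [[|[|//]] lti]; [left | right]; apply: val_inj.
Qed.

Lemma mdeg2E m : mdeg m = (m ord0 + m ord_max)%N.
Proof.
by rewrite mdegE big_ord_recl big_ord1; congr (_ + m _)%N; apply: val_inj.
Qed.

Lemma mpolyX2E m :
  'X_[m] = varX ^+ m ord0 * varY ^+ m ord_max :> {mpoly K[2]}.
Proof.
rewrite mpolyXE_id big_ord_recl big_ord1.
by have -> : lift ord0 ord0 = ord_max :> 'I_2 by apply: val_inj.
Qed.

Lemma mpoly2_ind (S : {mpoly K[2]} -> Prop) :
    (forall c, S c%:MP) -> S varX -> S varY ->
    (forall p q, S p -> S q -> S (p + q)) ->
    (forall p q, S p -> S q -> S (p * q)) ->
  forall p, S p.
Proof.
move=> SC SX SY SD SM.
have SXn p (n : nat) : S p -> S (p ^+ n).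
  move=> Sp; elim: n => [|n IHn]; first by rewrite expr0 -mpolyC1.
  by rewrite exprS; apply: (SM).
elim/mpolyind => [|c m p _ _ Sp]; first by rewrite -mpolyC0.
apply: (SD) => //; rewrite -mul_mpolyC mpolyX2E.
by apply: (SM) => //; apply: (SM); apply: SXn.
Qed.

Lemma lrmorphC h c : h c%:MP = c%:MP.
Proof. by rewrite -alg_mpolyC linearZ rmorph1. Qed.

Lemma eq_lrmorph2 g h : g varX = h varX -> g varY = h varY -> g =1 h.
Proof.
move=> eX eY; elim/mpoly2_ind => // [c|p q ep eq|p q ep eq].
- by rewrite !lrmorphC.
- by rewrite !rmorphD /= ep eq.
- by rewrite !rmorphM /= ep eq.
Qed.

Definition subst2 P Q : {mpoly K[2]} -> {mpoly K[2]} :=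
  comp_mpoly [tuple P; Q].
HB.instance Definition _ P Q := GRing.LRMorphism.copy (subst2 P Q)
  (comp_mpoly [tuple P; Q]).

Lemma subst2X P Q : subst2 P Q varX = P.
Proof. by rewrite /subst2 comp_mpolyXU. Qed.

Lemma subst2Y P Q : subst2 P Q varY = Q.
Proof. by rewrite /subst2 comp_mpolyXU. Qed.

(** Hides the substitution behind its two values, so that simplification
    does not unfold it. *)
Lemma lrmorph2_exists P Q :
  exists h : {lrmorphism {mpoly K[2]} -> {mpoly K[2]}},
    h varX = P /\ h varY = Q.
Proof. by exists (subst2 P Q); rewrite /= subst2X subst2Y. Qed.

Lemma subst2E P Q p :
  subst2 P Q p = \sum_(m <- msupp p) p@_m *: (P ^+ m ord0 * Q ^+ m ord_max).
Proof.
rewrite /subst2 comp_mpolyEX; apply: eq_bigr => m _; congr (_ *: _).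
by rewrite mpolyX2E rmorphM !rmorphXn /= !comp_mpolyXU.
Qed.

Lemma lrmorph_subst2 h P Q p : h (subst2 P Q p) = subst2 (h P) (h Q) p.
Proof.
apply: (@eq_lrmorph2 (h \o subst2 P Q) (subst2 (h P) (h Q))).
  by rewrite /= !subst2X.
by rewrite /= !subst2Y.
Qed.

Lemma mcoeff_subst2_X0 p m :
  m ord_max = 0%N -> (subst2 varX 0 p)@_m = p@_m.
Proof.
move=> m1; rewrite subst2E [in RHS](mpolyE p) !raddf_sum.
apply: eq_bigr => n _ /=; rewrite !mcoeffZ mpolyX2E.
have [n1|n1] := posnP (n ord_max); first by rewrite n1 !expr0.
rewrite expr0n eqn0Ngt n1 /= mulr0 mcoeff0 -mpolyX2E mcoeffX.
by case: eqP => // e; rewrite -e in m1; rewrite m1 in n1.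
Qed.

Lemma subst2_0Y p :
  {in msupp p, forall m, m ord0 = 0%N} -> subst2 0 varY p = p.
Proof.
move=> p0; rewrite subst2E [RHS](mpolyE p).
by apply: eq_big_seq => n /p0 n0; rewrite mpolyX2E n0 !expr0.
Qed.

(** The inverse is [X |-> b (X - r (a Y)), Y |-> a Y]. *)
Lemma triangular_bijective g (a b : K) r :
    a * b = 1 -> {in msupp r, forall m, m ord0 = 0%N} ->
    g varX = a *: varX + r -> g varY = b *: varY ->
  bijective g.
Proof.
move=> ab r0 gX gY.
have [h [hX hY]] :=
  lrmorph2_exists (b *: (varX - subst2 0 (a *: varY) r)) (a *: varY).
exists h => p.
- apply: (@eq_lrmorph2 (h \o g) idfun) => /=.
    rewrite gX rmorphD /= linearZ /= hX scalerA ab scale1r -{2}(subst2_0Y r0).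
    by rewrite lrmorph_subst2 hY rmorph0 subrK.
  by rewrite gY linearZ /= hY scalerA mulrC ab scale1r.
- apply: (@eq_lrmorph2 (g \o h) idfun) => /=.
    rewrite hX linearZ rmorphB /= lrmorph_subst2 linearZ /= rmorph0 gY gX.
    by rewrite scalerA ab scale1r subst2_0Y // addrK scalerA mulrC ab scale1r.
  by rewrite hY linearZ /= gY scalerA ab scale1r.
Qed.

(** * The Jacobian: chain rule and expansion on monomials *)

Lemma mderivXU (i j : 'I_2) : 'X_i^`M(j) = (i == j)%:R :> {mpoly K[2]}.
Proof.
rewrite mderivX mnm1E; case: eqP => [->|_]; last by rewrite scale0r.
by rewrite scale1r -[RHS]mpolyX0 -{1}[U_(j)%MM]add0m addmK.
Qed.

Lemma mderiv_lrmorph h p i :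
  (h p)^`M(i) = h p^`M(ord0) * (h varX)^`M(i)
              + h p^`M(ord_max) * (h varY)^`M(i).
Proof.
elim/mpoly2_ind: p => [c|||p q ep eq|p q ep eq].
- by rewrite lrmorphC !mderivC !rmorph0; ring.
- by rewrite !mderivXU /= rmorph1 rmorph0; ring.
- by rewrite !mderivXU /= rmorph1 rmorph0; ring.
- by rewrite !(rmorphD, mderivD) ep eq; ring.
- by rewrite !(rmorphM, rmorphD, mderivM) ep eq; ring.
Qed.

Lemma Jac_lrmorph h p q :
  Jac (h p) (h q) = h (Jac p q) * Jac (h varX) (h varY).
Proof.
rewrite /Jac !(mderiv_lrmorph h p) !(mderiv_lrmorph h q) rmorphB !rmorphM.
by ring.
Qed.

(** The factor [X Y] turns the partial derivatives into the Euler operators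
    [X d/dX] and [Y d/dY], which act diagonally on monomials; it thereby
    removes the exponent shifts, and with them truncated subtractions. *)
Lemma XY_Jac_sum A B : varX * varY * Jac A B =
  \sum_(m <- msupp A) \sum_(n <- msupp B)
    (((m ord0 * n ord_max)%:R - (m ord_max * n ord0)%:R) * A@_m * B@_n)
      *: 'X_[m + n] :> {mpoly K[2]}.
Proof.
have euler i p :
    'X_i * p^`M(i) = \sum_(m <- msupp p) ((m i)%:R * p@_m) *: 'X_[m].
  rewrite {1}[p]mpolyE raddf_sum mulr_sumr; apply: eq_bigr => m _ /=.
  rewrite mderivZ mderivX scalerA [_ * _%:R]mulrC -scalerAr -mpolyXD.
  case: (posnP (m i)) => [->|mi_gt0]; first by rewrite !mul0r !scale0r.
  by rewrite addmC submK // lep1mP -lt0n.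
have -> : varX * varY * Jac A B =
    ('X_ord0 * A^`M(ord0)) * ('X_ord_max * B^`M(ord_max))
    - ('X_ord_max * A^`M(ord_max)) * ('X_ord0 * B^`M(ord0)).
  by rewrite /Jac /varX /varY; ring.
rewrite !euler !mulr_suml -sumrB; apply: eq_bigr => m _.
rewrite !mulr_sumr -sumrB; apply: eq_bigr => n _.
rewrite -!scalerAl -!scalerAr !scalerA -mpolyXD -scalerBl; congr (_ *: _).
by rewrite !natrM; ring.
Qed.

End TwoVariables.

Arguments subst2 {K}.

(** * Newton polygons of a Jacobian pair *)

Lemma seq_max d (T : orderType d) (I : eqType) (F : I -> T) (s : seq I) x0 :
  x0 \in s -> exists2 x, x \in s & {in s, forall y, (F y <= F x)%O}.
Proof.
elim: s x0 => // a s IHs _ _.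
case: s IHs => [|b s] IHs.
  by exists a; rewrite ?mem_head // => y; rewrite inE => /eqP->.
have [x xs xmax] := IHs b (mem_head b s).
have [le_ax|lt_xa] := Order.TotalTheory.leP (F a) (F x).
  exists x; first by rewrite inE xs orbT.
  by move=> y; rewrite inE => /predU1P[->|/xmax].
exists a; first exact: mem_head.
move=> y; rewrite inE => /predU1P[->//|/xmax le_yx].
exact: Order.POrderTheory.le_trans le_yx (Order.POrderTheory.ltW lt_xa).
Qed.

Section JacobianPair.
Set Implicit Arguments.
Unset Strict Implicit.

Variable K : fieldType.
Implicit Types (m n : 'X_{1..2}) (A B : {mpoly K[2]}).

Lemma eqr_nat_pchar0 (a b : nat) :
  [pchar K] =i pred0 -> (a%:R == b%:R :> K) = (a == b).
Proof.
move=> charK0; wlog le_ab : a b / (a <= b)%N => [W|].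
  by case/orP: (leq_total a b) => /W // e; rewrite eq_sym e eq_sym.
rewrite eq_sym -subr_eq0 -natrB // (pcharf0P K).1 //.
by rewrite subn_eq0 eqn_leq le_ab.
Qed.

Lemma Jac1_unique_sum A B m n :
    [pchar K] =i pred0 -> Jac A B = 1 ->
    m \in msupp A -> n \in msupp B ->
    {in msupp A & msupp B, forall m' n',
      (m' + n' = m + n)%MM -> m' = m /\ n' = n} ->
    (m ord0 * n ord_max != m ord_max * n ord0)%N ->
  (m ord0 + n ord0 = 1 /\ m ord_max + n ord_max = 1)%N.
Proof.
move=> charK0 JAB mA nB uniq_mn det_mn.
have: (varX * varY * Jac A B)@_(m + n) != 0.
  rewrite XY_Jac_sum raddf_sum (bigD1_seq m) //= raddf_sum (bigD1_seq n) //=.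
  rewrite mcoeffZ mcoeffX eqxx mulr1 !big1_seq ?addr0.
  - by rewrite !mulf_neq0 -?mcoeff_msupp // subr_eq0 eqr_nat_pchar0.
  - move=> m' /andP[m'_neq m'A]; rewrite raddf_sum big1_seq //= => n' n'B.
    rewrite mcoeffZ mcoeffX; case: eqP => [e|]; last by rewrite mulr0.
    by have [e1] := uniq_mn _ _ m'A n'B e; rewrite e1 eqxx in m'_neq.
  - move=> n' /andP[n'_neq n'B].
    rewrite mcoeffZ mcoeffX; case: eqP => [e|]; last by rewrite mulr0.
    by have [_ e1] := uniq_mn _ _ mA n'B e; rewrite e1 eqxx in n'_neq.
rewrite JAB mulr1 -mpolyXD mcoeffX.
case: (_ =P (m + n)%MM) => [e _|_]; last by rewrite eqxx.
by rewrite -!mnmDE -e !mnmDE !mnm1E.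
Qed.

(** The exponents of maximal weight are [(1,0) + t z] in [A] and [(0,1) + t z]
    in [B], with [z] proportional to [(-q, p)].  Both coordinates of
    [z] are nonnegative, so on each of the two lines the degree singles out the
    farthest exponent, and the determinant of two farthest exponents
    [(1 + x, y)] and [(x', 1 + y')] is [1 + x + y'], as [(x, y)] and
    [(x', y')] are proportional. *)
Lemma mdeg_leading_form_le1 A B (p q : int) :
    [pchar K] =i pred0 -> Jac A B = 1 ->
    q <= 0 <= p -> q < p ->
    U_(ord0)%MM \in msupp A -> U_(ord_max)%MM \in msupp B ->
    {in msupp A, forall m, p * (m ord0)%:Z + q * (m ord_max)%:Z <= p} ->
    {in msupp B, forall m, p * (m ord0)%:Z + q * (m ord_max)%:Z <= q} ->
  {in msupp A, forall m,
    p * (m ord0)%:Z + q * (m ord_max)%:Z = p -> (mdeg m <= 1)%N} /\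
  {in msupp B, forall m,
    p * (m ord0)%:Z + q * (m ord_max)%:Z = q -> (mdeg m <= 1)%N}.
Proof.
move=> charK0 JAB /andP[q_le0 p_ge0] q_lt_p XA YB wtA wtB.
pose wt m := p * (m ord0)%:Z + q * (m ord_max)%:Z.
have top (s : seq 'X_{1..2}) u : u \in s ->
    exists m, [/\ m \in s, wt m = wt u, (mdeg u <= mdeg m)%N &
      {in s, forall n, wt n = wt u -> (mdeg n <= mdeg m)%N}].
  move=> us; pose s' := [seq m <- s | wt m == wt u].
  have us' : u \in s' by rewrite mem_filter eqxx.
  have [m] := @seq_max _ nat _ (fun m : 'X_{1..2} => mdeg m) _ _ us'.
  rewrite mem_filter => /andP[/eqP wm ms] mmax; exists m; split => //.
  - exact: mmax.
  - by move=> n ns wn; apply: mmax; rewrite mem_filter wn eqxx.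
have [a [aA wa da amax]] := top _ _ XA.
have [b [bB wb db bmax]] := top _ _ YB.
have wX : wt U_(ord0)%MM = p by rewrite /wt !mnm1E /=; lia.
have wY : wt U_(ord_max)%MM = q by rewrite /wt !mnm1E /=; lia.
rewrite wX wY !mdeg1 in wa da amax wb db bmax.
have [||e0 e1] := Jac1_unique_sum charK0 JAB aA bB.
- move=> m n mA nB e.
  have e0 : (m ord0 + n ord0 = a ord0 + b ord0)%N by rewrite -!mnmDE e.
  have e1 : (m ord_max + n ord_max = a ord_max + b ord_max)%N.
    by rewrite -!mnmDE e.
  have wm : wt m <= p := wtA _ mA.
  have wn : wt n <= q := wtB _ nB.
  have wmn : wt m + wt n = wt a + wt b.
    have -> : wt m + wt n = p * (m ord0 + n ord0)%N%:Z
                          + q * (m ord_max + n ord_max)%N%:Z.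
      by rewrite /wt; lia.
    by rewrite e0 e1 /wt; lia.
  have wm' : wt m = p by lia.
  have wn' : wt n = q by lia.
  have := amax _ mA wm'; have := bmax _ nB wn'.
  rewrite !mdeg2E => dn dm.
  have dm' : (m ord0 + m ord_max = a ord0 + a ord_max)%N by lia.
  (* Weight and degree are independent linear forms because [q < p]. *)
  have em : m ord0 = a ord0 by move: wm' wa; rewrite /wt; nia.
  by split; apply: mnm2P; lia.
- by move: wa wb da db; rewrite /wt !mdeg2E; nia.
split=> m mA.
- by move/(amax _ mA); move: da db; rewrite !mdeg2E; lia.
- by move/(bmax _ mA); move: da db; rewrite !mdeg2E; lia.
Qed.

(** For a [B] vanishing on the axis [Y = 0], this is the constant term of
    [Jac A B = 1]. *)
Lemma linear_coeffs_mul1 A B :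
    Jac A B = 1 -> {in msupp B, forall m, (0 < m ord_max)%N} ->
  A@_U_(ord0) * B@_U_(ord_max) = 1.
Proof.
move=> JAB B0; have := congr1 (mcoeff 0%MM) JAB.
rewrite rmorph1 /Jac rmorphB !rmorphM /= !mcoeff_mderiv.
rewrite !add0m !mnm0E !mulr1n.
suff -> : B@_U_(ord0) = 0 by rewrite mulr0 subr0.
by apply/memN_msupp_eq0/negP => /B0; rewrite mnm1E.
Qed.

(** The forbidden exponents, translated by [-(1,0)] for [A] and by [-(0,1)]
    for [B], are nonzero vectors with nonnegative coordinates.  If there is
    one, let [(x, y)] be one that is closest in direction to the first
    coordinate axis: every forbidden exponent then has at most the
    weight of [X], resp. [Y], for the weight [y * m0 - x * m1]. *)
Lemma msupp_triangular A B :
    [pchar K] =i pred0 -> Jac A B = 1 ->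
    {in msupp B, forall m, (0 < m ord_max)%N} ->
  {in msupp A, forall m, m ord0 = 0%N \/ m = U_(ord0)%MM} /\
  {in msupp B, forall m, m = U_(ord_max)%MM}.
Proof.
move=> charK0 JAB B0; have ab1 := linear_coeffs_mul1 JAB B0.
have XA : U_(ord0)%MM \in msupp A.
  rewrite mcoeff_msupp; apply/eqP => e; move/eqP: ab1.
  by rewrite e mul0r eq_sym oner_eq0.
have YB : U_(ord_max)%MM \in msupp B.
  rewrite mcoeff_msupp; apply/eqP => e; move/eqP: ab1.
  by rewrite e mulr0 eq_sym oner_eq0.
pose sA := [seq ((m ord0).-1, m ord_max) |
             m : 'X_{1..2} <- msupp A & (0 < m ord0)%N && (m != U_(ord0)%MM)].
pose sB := [seq (m ord0, (m ord_max).-1) |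
             m : 'X_{1..2} <- msupp B & m != U_(ord_max)%MM].
have sA_mem m : m \in msupp A -> (0 < m ord0)%N -> m != U_(ord0)%MM ->
    ((m ord0).-1, m ord_max) \in sA ++ sB.
  move=> mA m0 mX; rewrite mem_cat; apply/orP; left.
  by apply: map_f; rewrite mem_filter m0 mX.
have sB_mem m : m \in msupp B -> m != U_(ord_max)%MM ->
    (m ord0, (m ord_max).-1) \in sA ++ sB.
  move=> mB mY; rewrite mem_cat; apply/orP; right.
  by apply: map_f; rewrite mem_filter mY.
suff s0 z : z \notin sA ++ sB.
  split=> m ms.
    have [->|m0] := posnP (m ord0); [by left | right].
    by apply/eqP; apply: contraNT (s0 _) => mX; exact: sA_mem mX.
  by apply/eqP; apply: contraNT (s0 _) => mX; exact: sB_mem mX.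
have s_neq0 t : t \in sA ++ sB -> (0 < t.1 + t.2)%N.
  rewrite mem_cat => /orP[] /mapP[m]; rewrite mem_filter.
    case/andP => /andP[m0 /eqP mX] _ -> /=; rewrite lt0n; apply/eqP => e.
    by apply: mX; apply: mnm2P; rewrite mnm1E /=; lia.
  case/andP => /eqP mY /B0 m1 -> /=; rewrite lt0n; apply/eqP => e.
  by apply: mY; apply: mnm2P; rewrite mnm1E /=; lia.
(* Dividing by the sum of the coordinates rather than by the second one
   keeps the slope finite for vectors along the first axis. *)
apply/negP; pose slope (t : nat * nat) : rat := t.1%:R / (t.1 + t.2)%:R.
move=> /(@seq_max _ _ _ slope)[[x y] xys xy_max].
have xy0 := s_neq0 _ xys; rewrite /= in xy0.
have {}xy_max u v : (u, v) \in sA ++ sB -> (u * y <= x * v)%N.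
  move=> uvs; have := xy_max _ uvs; rewrite /slope /=.
  have uv0 := s_neq0 _ uvs; rewrite /= in uv0.
  rewrite Num.Theory.ler_pdivrMr ?Num.Theory.ltr0n // mulrAC.
  rewrite Num.Theory.ler_pdivlMr ?Num.Theory.ltr0n //.
  by rewrite -!natrM Num.Theory.ler_nat; lia.
have [||m mA|m mB|topA topB] :=
  @mdeg_leading_form_le1 A B y%:Z (- x%:Z) charK0 JAB _ _ XA YB.
- by lia.
- by lia.
- have [m0|m0] := posnP (m ord0); first by rewrite m0; nia.
  have [->|mX] := eqVneq m U_(ord0)%MM; first by rewrite !mnm1E /=; lia.
  have := xy_max _ _ (sA_mem _ mA m0 mX).
  have -> : m ord0 = (m ord0).-1.+1 by lia.
  by nia.
- have m1 := B0 _ mB.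
  have [->|mY] := eqVneq m U_(ord_max)%MM; first by rewrite !mnm1E /=; lia.
  have := xy_max _ _ (sB_mem _ mB mY).
  have -> : m ord_max = (m ord_max).-1.+1 by lia.
  by nia.
move: xys; rewrite mem_cat => /orP[] /mapP[m]; rewrite mem_filter.
  move=> /andP[/andP[m0 _] mA] [ex ey].
  have : (mdeg m <= 1)%N by apply: topA => //; nia.
  by rewrite mdeg2E; lia.
move=> /andP[_ mB] [ex ey]; have m1 := B0 _ mB.
have : (mdeg m <= 1)%N by apply: topB => //; nia.
by rewrite mdeg2E; lia.
Qed.

(** * From the diagonal to a coordinate axis *)

Lemma keller_axis_bijective
    (g : {lrmorphism {mpoly K[2]} -> {mpoly K[2]}}) :
    [pchar K] =i pred0 -> Jac (g varX) (g varY) = 1 ->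
    subst2 varX 0 (g varY) = 0 ->
  bijective g.
Proof.
move=> charK0 Jg gY0.
have B0 : {in msupp (g varY), forall m, (0 < m ord_max)%N}.
  move=> m; rewrite mcoeff_msupp lt0n; apply: contra => /eqP m1.
  by rewrite -mcoeff_subst2_X0 // gY0 mcoeff0.
have [sA sB] := msupp_triangular charK0 Jg B0.
have ab := linear_coeffs_mul1 Jg B0.
set a := (X in X * _) in ab; set b := (X in _ * X) in ab.
apply: (@triangular_bijective _ _ a b (g varX - a *: varX) ab).
- move=> m; rewrite mcoeff_msupp mcoeffB mcoeffZ mcoeffX.
  case: (_ =P m) => [<-|/eqP mX]; first by rewrite mulr1 subrr eqxx.
  rewrite mulr0 subr0 -mcoeff_msupp => /sA[] // e.
  by rewrite e eqxx in mX.
- by rewrite addrC subrK.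
apply/mpolyP => m; rewrite mcoeffZ mcoeffX.
case: eqP => [<-|mY]; first by rewrite mulr1.
rewrite mulr0; apply/memN_msupp_eq0/negP => /sB e.
by rewrite e in mY.
Qed.

End JacobianPair.

Theorem proposition4p1 (K : fieldType) (charK0 : [pchar K] =i pred0)
    (f : {lrmorphism {mpoly K[2]} -> {mpoly K[2]}}) :
  alpha_morphism f -> Jac (f varX) (f varY) = 1 -> bijective f.
Proof.
move=> f_alpha Jf.
have [lam [lamX lamY]] := @lrmorph2_exists K varX (varX - varY).
have lamK : involutive lam.
  move=> p; apply: (@eq_lrmorph2 _ (lam \o lam) idfun) => /=.
    by rewrite !lamX.
  by rewrite lamY rmorphB /= lamX lamY subKr.
have lam_bij : bijective lam by exists lam.
have Jlam : Jac (lam varX) (lam varY) = -1.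
  by rewrite lamX lamY /Jac !mderivB !mderivXU /=; ring.
pose g : {lrmorphism {mpoly K[2]} -> {mpoly K[2]}} := lam \o (f \o lam).
have Jg : Jac (g varX) (g varY) = 1.
  by rewrite /= Jac_lrmorph (Jac_lrmorph f) Jlam Jf mulr1 !rmorphN1; ring.
have gY0 : subst2 varX 0 (g varY) = 0.
  set D := f (varX - varY).
  (* [lam] maps the axis [Y = 0] to the diagonal. *)
  have gYE : subst2 varX 0 (g varY) = subst2 varX varX D.
    rewrite /= lamY -/D.
    apply: (@eq_lrmorph2 _ (subst2 varX 0 \o lam) (subst2 varX varX)) => /=.
      by rewrite lamX !subst2X.
    by rewrite lamY rmorphB /= !subst2X !subst2Y subr0.
  have D_anti : exchange D = - D.
    have /= <- := f_alpha (varX - varY).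
    by rewrite rmorphB /= exchangeX exchangeY -opprB rmorphN.
  have diag_exchange (p : {mpoly K[2]}) :
      subst2 varX varX (exchange p) = subst2 varX varX p.
    rewrite -[exchange p]/(subst2 varY varX p) lrmorph_subst2 /=.
    by rewrite subst2X subst2Y.
  have := diag_exchange D; rewrite D_anti rmorphN /= gYE => /eqP.
  rewrite eq_sym -subr_eq0 opprK -mulr2n -scaler_nat scaler_eq0.
  by rewrite (pcharf0P K).1 //= => /eqP.
have [h gK hK] := keller_axis_bijective charK0 Jg gY0.
apply: (eq_bij (f := lam \o (g \o lam))).
  by apply: bij_comp => //; apply: bij_comp => //; exists h.
by move=> p /=; rewrite !lamK.
Qed.
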